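(* For $\alpha\in\mathbb{N}_0$, $\lambda,\eta,\delta\in\mathbb{C}$ and $n\in\mathbb{N}$, the following relation holds: $${}_{\mathfrak{B}}\mathcal{F}_n^{(\alpha)}(x_1+x_2,x_3;\lambda;\eta,\delta)=\sum_{k=0}^{n}\binom{n}{k}\,\mathcal{F}_k^{(\alpha)}(x_1;\lambda;\eta,\delta)\,\mathfrak{B}_{n-k}(x_2,x_3).$$
   Context: $\mathbb{N}$ is the set of natural numbers, $\mathbb{N}_0$ the set of non-negative integers, $\mathbb{C}$ the set of complex numbers; $x_1,x_2,x_3$ are variables. For $\alpha\in\mathbb{N}_0$ and $\lambda,\eta,\delta\in\mathbb{C}$, the Bell based Apostol type polynomials ${}_{\mathfrak{B}}\mathcal{F}_n^{(\alpha)}(x,y;\lambda;\eta,\delta)$ of order $\alpha$ are defined by the generating function $$\sum_{n\ge 0}{}_{\mathfrak{B}}\mathcal{F}_n^{(\alpha)}(x,y;\lambda;\eta,\delta)\frac{t^n}{n!}=\left(\frac{2^{\eta}t^{\delta}}{\lambda e^{t}+1}\right)^{\alpha}e^{xt+y(e^t-1)},\qquad |t|<|\log(-\lambda)|.$$ The generalized Apostol type polynomials $\mathcal{F}_n^{(\alpha)}(x;\lambda;\eta,\delta)$ of order $\alpha$ ($\alpha\in\mathbb{N}_0$, $\lambda,\eta,\delta\in\mathbb{C}$) are defined by $$\sum_{n\ge 0}\mathcal{F}_n^{(\alpha)}(x;\lambda;\eta,\delta)\frac{t^n}{n!}=\left(\frac{2^{\eta}t^{\delta}}{\lambda e^{t}+1}\right)^{\alpha}e^{xt},\qquad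 |t|<|\log(-\lambda)|.$$ The bivariate Bell polynomials $\mathfrak{B}_n(x,y)$ are defined by $\sum_{n\ge 0}\mathfrak{B}_n(x,y)\frac{t^n}{n!}=e^{xt}e^{y(e^t-1)}$. *)

(* Defs.v *)
From Stdlib Require Import Reals Factorial ClassicalEpsilon.
From Coquelicot Require Export Coquelicot.
Open Scope C_scope.

(** Complex exponential, principal logarithm and principal powers *)

Definition Cexp (z : C) : C :=
  (exp (Re z) * cos (Im z), exp (Re z) * sin (Im z))%R.

(* Values in (-PI, PI]; the value at 0 is irrelevant. *)
Definition Carg (z : C) : R :=
  if Rle_dec 0 (Im z) then acos (Re z / Cmod z) else (- acos (Re z / Cmod z))%R.

Definition Clog (z : C) : C := (ln (Cmod z), Carg z).

(* Principal value of z ^ w, meaningful for z <> 0 only. *)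
Definition Cpower (z w : C) : C := Cexp (w * Clog z).

(** Exponential generating functions *)

Definition is_egf (D : C -> Prop) (G : C -> C) (a : nat -> C) : Prop :=
  forall t : C, D t ->
    is_series (K := C_AbsRing) (V := C_NormedModule)
      (fun n => a n * (t ^ n / RtoC (INR (fact n)))) (G t).

(* The coefficient sequence of G, unique as soon as D contains all small
   t <> 0; the zero sequence by convention when G has no such expansion on D. *)
Definition egf_coeff (D : C -> Prop) (G : C -> C) : nat -> C :=
  match excluded_middle_informative (exists a, is_egf D G a) with
  | left h => proj1_sig (constructive_indefinite_description _ h)
  | right _ => fun _ => 0
  end.

Lemma egf_coeff_spec (D : C -> Prop) (G : C -> C) :
  (exists a, is_egf D G a) -> is_egf D G (egf_coeff D G).
Proof.
intros h. unfold egf_coeff.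
destruct (excluded_middle_informative _) as [h'|h']; [|contradiction].
exact (proj2_sig (constructive_indefinite_description _ h')).
Qed.

(** Apostol type and Bell polynomials *)

(* The disc |t| < |log (-lam)|, with its usual meaning in the two cases where
   the logarithm does not give the distance from 0 to the nearest nonzero zero
   of lam e^t + 1: no restriction for lam = 0 (log 0 is undefined and there is
   no zero), and |t| < 2 pi for lam = -1 (log 1 = 0 would make the disc empty).
   The point t = 0 is left out because t ^ delta and, for lam = -1, the quotient
   are given there by continuity only; this does not affect the coefficients. *)
Definition apostol_domain (lam t : C) : Prop :=
  t <> 0 /\
  (lam <> 0 -> lam <> - 1 -> (Cmod t < Cmod (Clog (- lam)))%R) /\
  (lam = - 1 -> (Cmod t < 2 * PI)%R).

Definition apostol_factor (alpha : nat) (lam eta delta t : C) : C :=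
  (Cpower 2 eta * Cpower t delta / (lam * Cexp t + 1)) ^ alpha.

Definition bell_apostol
    (alpha : nat) (lam eta delta x y : C) (n : nat) : C :=
  egf_coeff (apostol_domain lam)
    (fun t => apostol_factor alpha lam eta delta t
              * Cexp (x * t + y * (Cexp t - 1))) n.

Definition apostol (alpha : nat) (lam eta delta x : C) (n : nat) : C :=
  egf_coeff (apostol_domain lam)
    (fun t => apostol_factor alpha lam eta delta t * Cexp (x * t)) n.

Definition bell (x y : C) (n : nat) : C :=
  egf_coeff (fun _ => True)
    (fun t => Cexp (x * t) * Cexp (y * (Cexp t - 1))) n.

(* Main.v *)
Require Import Defs.
From Stdlib Require Import Reals.
From Coquelicot Require Import Coquelicot.
From Stdlib Require Import Factorial ClassicalEpsilon Lra Lia.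
Open Scope C_scope.

(** Since [e^((x1 + x2) t + x3 (e^t - 1))] is
    [e^(x1 t) * (e^(x2 t) e^(x3 (e^t - 1)))], the generating function on the
    left is the product of the generating functions of the two sequences on the
    right, and the identity is the comparison of coefficients in their Cauchy
    product. Three analytic facts make this rigorous.

    First, the Bell generating function is entire ([bell_egf_exists]). By
    Dobinski's formula it is an absolutely convergent sum of exponentials,
    [e^(-y) * sum_k y^k / k! * e^((x + k) t)], and such a sum may be re-expanded
    in powers of [t] ([is_egf_exponential_sum]). No double series is needed: the
    remainder bound [|e^z - sum_(k <= n) z^k / k!| <= 2^(-n) e^(3 |z|)]
    ([Cexp_remainder]), summed over the exponentials, shows that the partial
    sums in [t] converge geometrically.

    Second, expansions multiply on any domain each of whose points is dominated
    in modulus by another point of the domain ([is_egf_mult]): convergence at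
    the larger point gives absolute convergence at the smaller one. The domain
    of the Apostol type functions is a punctured disc or the punctured plane, so
    it qualifies ([apostol_domain_open]).

    Third, an expansion valid on a punctured real neighbourhood of 0 is unique
    ([is_egf_unique]).

    When the Apostol type function has an expansion, these facts give the
    identity. When it has none (for instance for [alpha = 1] and
    [delta = 1/2]), its coefficients are 0 by convention and so is the right-hand
    side. The Bell based function then has no expansion either, because
    multiplying one by the Bell function with parameters [- x2] and [- x3] would
    give an expansion of the Apostol type function; hence the left-hand side is
    0 too. *)

(** * Complex series *)

Local Notation is_cseries := (is_series (K := C_AbsRing) (V := C_NormedModule)).
Local Notation ex_cseries := (ex_series (K := C_AbsRing) (V := C_NormedModule)).

Lemma Re_sum_n (a : nat -> C) (n : nat) :
  Re (sum_n a n) = sum_n (fun k => Re (a k)) n.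
Proof.
induction n as [|n IH]; [now rewrite !sum_O|].
now rewrite !sum_Sn, <- IH.
Qed.

Lemma Im_sum_n (a : nat -> C) (n : nat) :
  Im (sum_n a n) = sum_n (fun k => Im (a k)) n.
Proof.
induction n as [|n IH]; [now rewrite !sum_O|].
now rewrite !sum_Sn, <- IH.
Qed.

Lemma is_cseries_Re_Im (a : nat -> C) (l : C) :
  is_cseries a l <->
  is_series (fun n => Re (a n)) (Re l) /\ is_series (fun n => Im (a n)) (Im l).
Proof.
unfold is_series. split.
- intros H.
  assert (H' := proj1 (filterlim_locally (U := C_UniformSpace) (sum_n a) l) H).
  split; apply filterlim_locally; intros eps; generalize (H' eps);
    apply filter_imp; intros n [H1 H2].
  + now rewrite <- Re_sum_n.
  + now rewrite <- Im_sum_n.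
- intros [H1 H2].
  assert (H1' := proj1 (filterlim_locally (U := R_UniformSpace) _ _) H1).
  assert (H2' := proj1 (filterlim_locally (U := R_UniformSpace) _ _) H2).
  apply (filterlim_locally (U := C_UniformSpace)). intros eps.
  generalize (filter_and _ _ (H1' eps) (H2' eps)); apply filter_imp.
  intros n [B1 B2]. rewrite <- Re_sum_n in B1. rewrite <- Im_sum_n in B2.
  now split.
Qed.

Lemma im_le_Cmod (z : C) : (Rabs (Im z) <= Cmod z)%R.
Proof. eapply Rle_trans; [apply Rmax_r | apply (Rmax_Cmod z)]. Qed.

Lemma Cmod_le_Re_Im (z : C) : (Cmod z <= Rabs (Re z) + Rabs (Im z))%R.
Proof.
assert (H : z = RtoC (Re z) + Ci * RtoC (Im z)).
{ destruct z as [x y]. unfold Cplus, Cmult, Ci, RtoC, Re, Im. cbn.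
  f_equal; ring. }
rewrite H at 1. eapply Rle_trans; [apply Cmod_triangle|].
rewrite Cmod_mult, Cmod_Ci, !Cmod_R. lra.
Qed.

(** The modulus of the sum of a complex series is at most the sum of any real
    series that dominates it termwise. *)
Lemma Cmod_is_cseries_le (a : nat -> C) (b : nat -> R) (l : C) (M : R) :
  (forall n, (Cmod (a n) <= b n)%R) -> is_cseries a l -> is_series b M ->
  (Cmod l <= M)%R.
Proof.
intros Hab Ha Hb.
apply (filterlim_le (F := eventually)
         (fun n => norm (sum_n a n : C_NormedModule)) (sum_n b) (Cmod l) M).
- exists 0%nat. intros n _.
  eapply Rle_trans;
    [apply (norm_sum_n_m (K := C_AbsRing) (V := C_NormedModule))|].
  apply sum_n_m_le. intros k. exact (Hab k).
- change (Cmod l) with (norm (l : C_NormedModule)).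
  apply (filterlim_comp _ _ _ (sum_n a) norm eventually _ _ Ha).
  apply (filterlim_norm (K := C_AbsRing) (V := C_NormedModule)).
- exact Hb.
Qed.

Lemma ex_cseries_le (a : nat -> C) (b : nat -> R) :
  (forall n, (Cmod (a n) <= b n)%R) -> ex_series b -> ex_cseries a.
Proof.
intros Hab Hb.
apply (ex_series_le (V := C_CompleteNormedModule) a b); [|exact Hb].
intros n. exact (Hab n).
Qed.

(** The Cauchy product of two absolutely convergent complex series. *)
Lemma is_cseries_mult (a b : nat -> C) (la lb : C) :
  is_cseries a la -> is_cseries b lb ->
  ex_series (fun n => Cmod (a n)) -> ex_series (fun n => Cmod (b n)) ->
  is_cseries (fun n => sum_n (fun k => a k * b (n - k)%nat) n) (la * lb).
Proof.
intros Ha Hb Aa Ab.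
apply is_cseries_Re_Im in Ha as [Har Hai].
apply is_cseries_Re_Im in Hb as [Hbr Hbi].
assert (Abs : forall c : nat -> C, ex_series (fun n => Cmod (c n)) ->
  ex_series (fun n => Rabs (Re (c n))) /\ ex_series (fun n => Rabs (Im (c n)))).
{ intros c Hc. split; (eapply @ex_series_le; [|exact Hc]); intros n;
    change norm with Rabs; rewrite Rabs_Rabsolu;
    [apply re_le_Cmod | apply im_le_Cmod]. }
destruct (Abs a Aa) as [Aar Aai]. destruct (Abs b Ab) as [Abr Abi].
apply is_cseries_Re_Im. split.
- eapply is_series_ext; [|apply (is_series_minus _ _ _ _
    (is_series_mult _ _ _ _ Har Hbr Aar Abr)
    (is_series_mult _ _ _ _ Hai Hbi Aai Abi))].
  intros n. change plus with Rplus. change opp with Ropp. cbv beta.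
  rewrite Re_sum_n, sum_n_Reals.
  etransitivity; [symmetry; apply minus_sum|].
  apply sum_eq. intros k _. now rewrite re_mult.
- rewrite im_mult. eapply is_series_ext; [|apply (is_series_plus _ _ _ _
    (is_series_mult _ _ _ _ Har Hbi Aar Abi)
    (is_series_mult _ _ _ _ Hai Hbr Aai Abr))].
  intros n. cbv beta.
  rewrite Im_sum_n, <- !sum_n_Reals.
  rewrite <- (sum_n_plus (G := R_AbelianMonoid)).
  apply sum_n_ext. intros k. now rewrite im_mult.
Qed.

(** The next six lemmas restate facts on normed modules with the operations of
    [C] in place of the abstract ones. *)
Lemma C_sum_n_mult_l (a : C) (u : nat -> C) (n : nat) :
  sum_n (fun k => a * u k) n = a * sum_n u n.
Proof. exact (sum_n_mult_l (K := C_Ring) a u n). Qed.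

Lemma C_sum_n_mult_r (a : C) (u : nat -> C) (n : nat) :
  sum_n (fun k => u k * a) n = sum_n u n * a.
Proof. exact (sum_n_mult_r (K := C_Ring) a u n). Qed.

Lemma C_sum_n_ext (u v : nat -> C) (n : nat) :
  (forall k, (k <= n)%nat -> u k = v k) -> sum_n u n = sum_n v n.
Proof. exact (sum_n_ext_loc u v n). Qed.

Lemma is_cseries_ext (u v : nat -> C) (l : C) :
  (forall n, u n = v n) -> is_cseries u l -> is_cseries v l.
Proof. exact (is_series_ext u v l). Qed.

Lemma is_cseries_scal (a : C) (u : nat -> C) (l : C) :
  is_cseries u l -> is_cseries (fun n => a * u n) (a * l).
Proof. exact (is_series_scal_l (K := C_AbsRing) (V := C_NormedModule) a u l). Qed.

Lemma is_cseries_minus (u v : nat -> C) (l m : C) :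
  is_cseries u l -> is_cseries v m -> is_cseries (fun n => u n - v n) (l - m).
Proof. exact (is_series_minus (K := C_AbsRing) (V := C_NormedModule) u v l m). Qed.

Lemma is_cseries_sum_n (u : nat -> nat -> C) (l : nat -> C) (n : nat) :
  (forall m, is_cseries (u m) (l m)) ->
  is_cseries (fun k => sum_n (fun m => u m k) n) (sum_n l n).
Proof.
intros H. induction n as [|n IH].
- rewrite sum_O. eapply is_series_ext; [|apply (H 0%nat)].
  intros k. now rewrite sum_O.
- rewrite sum_Sn.
  eapply is_series_ext; [|exact (is_series_plus _ _ _ _ IH (H (S n)))].
  intros k. now rewrite sum_Sn.
Qed.

Lemma ex_cseries_Series (u : nat -> C) :
  ex_cseries u ->
  is_cseries u (Series (fun k => Re (u k)), Series (fun k => Im (u k))).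
Proof.
intros [l Hl]. apply is_cseries_Re_Im in Hl as [HR HI].
apply is_cseries_Re_Im. cbn [Re Im fst snd].
split; apply Series_correct; eexists; eassumption.
Qed.

Lemma is_cseries_of_remainder (u : nat -> C) (l : C) :
  is_lim_seq (fun n => Cmod (l - sum_n u n)) 0 -> is_cseries u l.
Proof.
intros H. apply is_lim_seq_spec in H.
apply (filterlim_locally_ball_norm (K := C_AbsRing) (U := C_NormedModule)).
intros eps. generalize (H eps). apply filter_imp. intros n Hn.
unfold ball_norm.
change (Cmod (sum_n u n - l) < eps)%R.
rewrite Rminus_0_r, Rabs_pos_eq in Hn by apply Cmod_ge_0.
rewrite <- Cmod_opp. now replace (- (sum_n u n - l)) with (l - sum_n u n) by ring.
Qed.

(** * The complex exponential *)

Lemma exp_le_exp (r s : R) : (r <= s)%R -> (exp r <= exp s)%R.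
Proof. intros [H | ->]; [left; now apply exp_increasing | apply Rle_refl]. Qed.

Lemma Cexp_plus (z w : C) : Cexp (z + w) = Cexp z * Cexp w.
Proof.
destruct z as [a b], w as [c d].
unfold Cexp, Cmult, Cplus; cbn. rewrite exp_plus, cos_plus, sin_plus.
f_equal; ring.
Qed.

Lemma Cexp_0 : Cexp 0 = 1.
Proof.
unfold Cexp, RtoC; cbn. rewrite exp_0, cos_0, sin_0. f_equal; ring.
Qed.

Lemma Cmod_Cexp_le (z : C) : (Cmod (Cexp z) <= exp (Cmod z))%R.
Proof.
assert (E : Cmod (Cexp z) = exp (Re z)).
{ unfold Cmod, Cexp; cbn -[exp].
  transitivity (sqrt (Rsqr (exp (Re z))));
    [|apply sqrt_Rsqr; left; apply exp_pos].
  f_equal. generalize (sin2_cos2 (Im z)). unfold Rsqr. intros H.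
  set (e := exp (Re z)). set (s := sin (Im z)) in *. set (c := cos (Im z)) in *.
  replace (e * e)%R with (e * e * (s * s + c * c))%R by (rewrite H; ring). ring. }
rewrite E. apply exp_le_exp. eapply Rle_trans; [apply Rle_abs | apply re_le_Cmod].
Qed.

Lemma is_derive_Re_Cexp_ray (w z : C) (s : R) :
  is_derive (fun s : R => Re (w * Cexp (RtoC s * z))) s
    (Re (w * z * Cexp (RtoC s * z))).
Proof.
destruct w as [a b], z as [c d].
unfold Cexp, Cmult, RtoC; cbn. auto_derive; [trivial|]. unfold Rminus. ring.
Qed.

Lemma is_derive_n_Re_Cexp_ray (w z : C) (n : nat) (s : R) :
  is_derive_n (fun s : R => Re (w * Cexp (RtoC s * z))) n s
    (Re (w * z ^ n * Cexp (RtoC s * z))).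
Proof.
revert s. induction n as [|n IH]; intros s.
- change (Re (w * Cexp (RtoC s * z)) = Re (w * 1 * Cexp (RtoC s * z))).
  now rewrite Cmult_1_r.
- change (is_derive (Derive_n (fun s : R => Re (w * Cexp (RtoC s * z))) n) s
    (Re (w * (z * z ^ n) * Cexp (RtoC s * z)))).
  apply is_derive_ext with
    (fun s : R => Re (w * z ^ n * Cexp (RtoC s * z))).
  + intros u. symmetry. now apply is_derive_n_unique.
  + replace (w * (z * z ^ n)) with (w * z ^ n * z) by ring.
    apply is_derive_Re_Cexp_ray.
Qed.

Lemma pow_div_fact_le_exp (r : R) (n : nat) :
  (0 <= r)%R -> (r ^ n / INR (fact n) <= exp r)%R.
Proof.
intros Hr.
assert (H0 : forall k, (0 <= / INR (fact k) * r ^ k)%R).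
{ intros k. apply Rmult_le_pos; [left; apply Rinv_0_lt_compat, INR_fact_lt_0|].
  now apply pow_le. }
assert (H := proj1 (is_pseries_R _ _ _) (is_exp_Reals r)).
rewrite <- (is_series_unique _ _ H).
eapply Rle_trans; [|apply (sum_incr (fun k => / INR (fact k) * r ^ k)%R n)].
- destruct n as [|n]; [right; simpl; field|]. rewrite tech5.
  generalize (cond_pos_sum _ n H0). unfold Rdiv.
  rewrite (Rmult_comm (r ^ S n)). intros. lra.
- rewrite (is_series_unique _ _ H). exact (proj1 (is_series_Reals _ _) H).
- exact H0.
Qed.

(** The partial sum, up to the power [n] included, of the exponential series. *)
Definition exp_partial (z : C) (n : nat) : C :=
  sum_n (fun k => z ^ k / RtoC (INR (fact k))) n.

Lemma RtoC_fact_neq_0 (n : nat) : RtoC (INR (fact n)) <> 0.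
Proof. intros E. exact (INR_fact_neq_0 n (RtoC_inj _ _ E)). Qed.

(** The Lagrange form of the Taylor remainder of the real function
    [s |-> Re (w * e^(s z))] between 0 and 1, estimated. The factor [w] gives access to
    both coordinates of [e^z]. *)
Lemma Re_Cexp_remainder (w z : C) (n : nat) :
  (Rabs (Re (w * (Cexp z - exp_partial z n)))
   <= Cmod w * (Cmod z ^ S n / INR (fact (S n))) * exp (Cmod z))%R.
Proof.
set (f := fun s : R => Re (w * Cexp (RtoC s * z))).
destruct (Taylor_Lagrange f n 0 1 Rlt_0_1) as [s [Hs E]].
{ intros t _ k _. destruct k as [|k]; [exact I|].
  exists (Re (w * z ^ S k * Cexp (RtoC t * z))).
  apply (is_derive_n_Re_Cexp_ray w z (S k) t). }
assert (D : forall k t, Derive_n f k t = Re (w * z ^ k * Cexp (RtoC t * z))).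
{ intros k t. apply is_derive_n_unique, is_derive_n_Re_Cexp_ray. }
assert (R : Re (w * (Cexp z - exp_partial z n))
  = (Re (w * z ^ S n * Cexp (RtoC s * z)) / INR (fact (S n)))%R).
{ replace (w * (Cexp z - exp_partial z n))
    with (w * Cexp (RtoC 1 * z) - w * exp_partial z n)
    by (rewrite Cmult_1_l; ring).
  unfold Cminus. rewrite re_plus, re_opp.
  change (Re (w * Cexp (RtoC 1 * z))) with (f 1%R). rewrite E.
  assert (S0 : sum_f_R0 (fun m => ((1 - 0) ^ m / INR (fact m) * Derive_n f m 0)%R) n
          = Re (w * exp_partial z n)).
  { unfold exp_partial. rewrite <- C_sum_n_mult_l, Re_sum_n, sum_n_Reals.
    apply sum_eq. intros k _.
    rewrite D, Rminus_0_r, pow1, Cmult_0_l, Cexp_0, Cmult_1_r.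
    unfold Cdiv. rewrite <- RtoC_inv by apply INR_fact_neq_0. rewrite Cmult_assoc, re_scal_r.
    unfold Rdiv. ring. }
  rewrite S0, D, Rminus_0_r, pow1. unfold Rdiv. ring. }
rewrite R. unfold Rdiv. rewrite Rabs_mult.
rewrite (Rabs_pos_eq (/ _)) by (left; apply Rinv_0_lt_compat, INR_fact_lt_0).
assert (P := Rinv_0_lt_compat _ (INR_fact_lt_0 (S n))).
set (q := (/ INR (fact (S n)))%R) in *.
replace (Cmod w * (Cmod z ^ S n * q) * exp (Cmod z))%R
  with (Cmod w * Cmod z ^ S n * exp (Cmod z) * q)%R by ring.
apply Rmult_le_compat_r; [lra|].
eapply Rle_trans; [apply re_le_Cmod|].
rewrite !Cmod_mult, Cmod_pow. apply Rmult_le_compat_l.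
{ apply Rmult_le_pos; [apply Cmod_ge_0 | apply pow_le, Cmod_ge_0]. }
eapply Rle_trans; [apply Cmod_Cexp_le|]. apply exp_le_exp.
rewrite Cmod_mult, Cmod_R, Rabs_pos_eq by lra.
generalize (Cmod_ge_0 z). nra.
Qed.

(** Trading [e^(|z|)] for the larger [e^(3 |z|)] buys a geometric decay in [n]
    that is uniform in [z]. *)
Lemma Cexp_remainder (z : C) (n : nat) :
  (Cmod (Cexp z - exp_partial z n) <= (1 / 2) ^ n * exp (3 * Cmod z))%R.
Proof.
(* [w = 1] and [w = - Ci] select the real and the imaginary part. *)
set (u := Cexp z - exp_partial z n).
assert (HR := Re_Cexp_remainder 1 z n). assert (HI := Re_Cexp_remainder (- Ci) z n).
fold u in HR, HI. rewrite Cmult_1_l, Cmod_1 in HR.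
rewrite Cmod_opp, Cmod_Ci in HI.
replace (Re (- Ci * u)) with (Im u) in HI
  by (destruct u; unfold Cmult, Copp, Ci; cbn; ring).
eapply Rle_trans; [apply Cmod_le_Re_Im|].
(* [|z|^(n+1) / (n+1)!] is [2^(-(n+1))] times [(2 |z|)^(n+1) / (n+1)!]. *)
assert (B := pow_div_fact_le_exp (2 * Cmod z) (S n)).
assert (Z := Cmod_ge_0 z). specialize (B ltac:(lra)).
replace (3 * Cmod z)%R with (2 * Cmod z + Cmod z)%R by ring.
rewrite exp_plus.
assert (E := exp_pos (Cmod z)).
apply Rle_trans with
  ((1 / 2) ^ n * ((2 * Cmod z) ^ S n / INR (fact (S n)) * exp (Cmod z)))%R.
- replace ((1 / 2) ^ n * ((2 * Cmod z) ^ S n / INR (fact (S n)) * exp (Cmod z)))%R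
    with (((1 / 2) ^ n * 2 ^ n) * 2 * (Cmod z ^ S n / INR (fact (S n))) * exp (Cmod z))%R
    by (rewrite Rpow_mult_distr; simpl pow; unfold Rdiv; ring).
  rewrite <- Rpow_mult_distr.
  replace (1 / 2 * 2)%R with 1%R by field. rewrite pow1. lra.
- apply Rmult_le_compat_l; [apply pow_le; lra|].
  apply Rmult_le_compat_r; [lra|exact B].
Qed.

Lemma Cexp_series (z : C) :
  is_cseries (fun n => z ^ n / RtoC (INR (fact n))) (Cexp z).
Proof.
apply is_cseries_of_remainder.
apply is_lim_seq_le_le with (fun _ => 0%R)
  (fun n => ((1 / 2) ^ n * exp (3 * Cmod z))%R).
- intros n. split; [apply Cmod_ge_0 | apply Cexp_remainder].
- apply is_lim_seq_const.
- evar_last; [apply (is_lim_seq_scal_r _ (exp (3 * Cmod z)) 0), is_lim_seq_geom;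
    rewrite Rabs_pos_eq; lra|]. simpl. f_equal. ring.
Qed.

(** * Sums of exponentials and the Bell generating function *)

(** A sum of exponentials [sum_k w_k e^(z_k t)] whose weights beat every
    [e^(c |z_k|)] is an entire function of [t]; the coefficients of its
    expansion are the moments [sum_k w_k z_k^n]. *)
Lemma is_egf_exponential_sum (w z : nat -> C) (G : C -> C) :
  (forall c : R, (0 <= c)%R ->
     ex_series (fun k => Cmod (w k) * exp (c * Cmod (z k)))%R) ->
  (forall t, is_cseries (fun k => w k * Cexp (z k * t)) (G t)) ->
  exists a, is_egf (fun _ => True) G a.
Proof.
intros Hw HG.
assert (Hm : forall n, exists l, is_cseries (fun k => w k * z k ^ n) l).
{ intros n.
  apply (ex_cseries_le _
    (fun k => INR (fact n) * (Cmod (w k) * exp (1 * Cmod (z k))))%R).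
  - intros k. rewrite Cmod_mult, Cmod_pow, Rmult_1_l.
    assert (B := pow_div_fact_le_exp (Cmod (z k)) n (Cmod_ge_0 _)).
    assert (F := INR_fact_lt_0 n).
    apply Rmult_le_compat_l with (r := INR (fact n)) in B; [|lra].
    replace (INR (fact n) * (Cmod (z k) ^ n / INR (fact n)))%R
      with (Cmod (z k) ^ n)%R in B by (field; lra).
    apply Rmult_le_compat_l with (r := Cmod (w k)) in B; [|apply Cmod_ge_0].
    lra.
  - apply (ex_series_scal_l (V := R_NormedModule) (INR (fact n))). apply Hw. lra. }
set (a := fun n => (Series (fun k => Re (w k * z k ^ n)),
                    Series (fun k => Im (w k * z k ^ n))) : C).
assert (Ha : forall n, is_cseries (fun k => w k * z k ^ n) (a n)).
{ intros n. apply (ex_cseries_Series _ (Hm n)). }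
exists a. intros t _.
(* The factor 3 is the one in [Cexp_remainder]. *)
destruct (Hw (3 * Cmod t)%R) as [M HM].
{ generalize (Cmod_ge_0 t). lra. }
apply is_cseries_of_remainder.
apply is_lim_seq_le_le with (fun _ => 0%R) (fun n => ((1 / 2) ^ n * M)%R).
- intros n. split; [apply Cmod_ge_0|].
  apply (Cmod_is_cseries_le
    (fun k => w k * Cexp (z k * t) - w k * exp_partial (z k * t) n)
    (fun k => ((1 / 2) ^ n * (Cmod (w k) * exp (3 * Cmod t * Cmod (z k))))%R)).
  + intros k.
    replace (w k * Cexp (z k * t) - w k * exp_partial (z k * t) n)
      with (w k * (Cexp (z k * t) - exp_partial (z k * t) n)) by ring.
    rewrite Cmod_mult.
    assert (B := Cexp_remainder (z k * t) n). rewrite Cmod_mult in B.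
    apply Rmult_le_compat_l with (r := Cmod (w k)) in B; [|apply Cmod_ge_0].
    replace (3 * Cmod t * Cmod (z k))%R with (3 * (Cmod (z k) * Cmod t))%R by ring.
    lra.
  + apply is_cseries_minus; [apply HG|].
    eapply is_cseries_ext; [|apply (is_cseries_sum_n
      (fun m k => (t ^ m / RtoC (INR (fact m))) * (w k * z k ^ m)))].
    * intros k. cbv beta. unfold exp_partial. rewrite <- C_sum_n_mult_l.
      apply C_sum_n_ext. intros m _. rewrite Cpow_mult_l. unfold Cdiv. ring.
    * intros m. rewrite Cmult_comm. apply is_cseries_scal, Ha.
  + apply (is_series_scal_l (V := R_NormedModule) ((1 / 2) ^ n)%R _ M HM).
- apply is_lim_seq_const.
- evar_last; [apply (is_lim_seq_scal_r _ M 0), is_lim_seq_geom;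
    rewrite Rabs_pos_eq; lra|]. simpl. f_equal. ring.
Qed.

Lemma Cexp_mult_INR (z : C) (k : nat) : Cexp (RtoC (INR k) * z) = Cexp z ^ k.
Proof.
induction k as [|k IH].
- simpl. now rewrite Cmult_0_l, Cexp_0.
- rewrite S_INR, RtoC_plus, Cpow_S, <- IH, <- Cexp_plus. f_equal. ring.
Qed.

(** The Bell generating function is entire: by Dobinski's formula it is the sum
    over [k] of [e^(-y) y^k / k! * e^((x + k) t)]. *)
Lemma bell_egf_exists (x y : C) :
  exists a, is_egf (fun _ => True)
    (fun t => Cexp (x * t) * Cexp (y * (Cexp t - 1))) a.
Proof.
apply (is_egf_exponential_sum
  (fun k => Cexp (- y) * (y ^ k / RtoC (INR (fact k))))
  (fun k => x + RtoC (INR k))).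
- intros c Hc.
  apply (ex_series_le (V := R_CompleteNormedModule) _
    (fun k => (Cmod (Cexp (- y)) * exp (c * Cmod x)
       * (/ INR (fact k) * (Cmod y * exp c) ^ k))%R)).
  + intros k. change norm with Rabs.
    rewrite Rabs_pos_eq
      by (apply Rmult_le_pos; [apply Cmod_ge_0 | left; apply exp_pos]).
    rewrite Cmod_mult, Cmod_div, Cmod_pow, Cmod_R
      by apply RtoC_fact_neq_0.
    rewrite (Rabs_pos_eq (INR _)) by apply pos_INR.
    assert (B : (exp (c * Cmod (x + RtoC (INR k))) <= exp (c * Cmod x) * exp c ^ k)%R).
    { assert (E : (exp c ^ k = exp (INR k * c))%R).
      { clear. induction k as [|k IH]; [simpl; now rewrite Rmult_0_l, exp_0|].
        rewrite S_INR, Rmult_plus_distr_r, exp_plus, <- IH, Rmult_1_l. simpl. ring. }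
      rewrite E, <- exp_plus. apply exp_le_exp.
      assert (T := Cmod_triangle x (RtoC (INR k))).
      rewrite Cmod_R, Rabs_pos_eq in T by apply pos_INR. nra. }
    rewrite Rpow_mult_distr.
    assert (P : (0 <= Cmod (Cexp (- y)) * (Cmod y ^ k / INR (fact k)))%R).
    { apply Rmult_le_pos; [apply Cmod_ge_0|]. apply Rmult_le_pos;
      [apply pow_le, Cmod_ge_0 | left; apply Rinv_0_lt_compat, INR_fact_lt_0]. }
    apply Rmult_le_compat_l with (1 := P) in B. unfold Rdiv in *. lra.
  + apply (ex_series_scal_l (V := R_NormedModule)).
    exists (exp (Cmod y * exp c)). apply is_pseries_R, is_exp_Reals.
- intros t.
  replace (Cexp (x * t) * Cexp (y * (Cexp t - 1)))
    with (Cexp (- y) * Cexp (x * t) * Cexp (y * Cexp t)).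
  2:{ rewrite <- !Cexp_plus. f_equal. ring. }
  eapply is_cseries_ext; [|apply is_cseries_scal, Cexp_series].
  intros k. cbv beta. rewrite Cmult_plus_distr_r, Cexp_plus, Cexp_mult_INR, Cpow_mult_l.
  unfold Cdiv. ring.
Qed.

(** * Products and uniqueness of expansions *)

Lemma abs_cvg_of_larger (a : nat -> C) (s t l : C) :
  is_cseries (fun n => a n * (s ^ n / RtoC (INR (fact n)))) l ->
  (Cmod t < Cmod s)%R ->
  ex_series (fun n => Cmod (a n * (t ^ n / RtoC (INR (fact n))))).
Proof.
intros Hs Hts.
set (al := fun n => (Cmod (a n) / INR (fact n))%R).
assert (E : forall u n, Cmod (a n * (u ^ n / RtoC (INR (fact n)))) = (al n * Cmod u ^ n)%R).
{ intros u n. rewrite Cmod_mult, Cmod_div, Cmod_pow, Cmod_R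
    by apply RtoC_fact_neq_0.
  rewrite Rabs_pos_eq by apply pos_INR. unfold al, Rdiv. ring. }
assert (L : is_lim_seq (fun n => al n * Cmod s ^ n)%R 0).
{ apply is_cseries_Re_Im in Hs as [HR HI].
  assert (LR := ex_series_lim_0 _ (ex_intro _ _ HR)).
  assert (LI := ex_series_lim_0 _ (ex_intro _ _ HI)).
  apply is_lim_seq_abs in LR. apply is_lim_seq_abs in LI.
  assert (LS := is_lim_seq_plus' _ _ _ _ LR LI).
  rewrite Rabs_R0, Rplus_0_r in LS.
  refine (is_lim_seq_le_le (fun _ => 0%R) _ _ 0 _ (is_lim_seq_const 0) LS).
  intros n. rewrite <- E. split; [apply Cmod_ge_0 | apply Cmod_le_Re_Im]. }
assert (R : Rbar_lt (Rabs (Cmod t)) (CV_radius al)).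
{ apply Rbar_lt_le_trans with (Rabs (Cmod s)).
  - simpl. now rewrite !Rabs_pos_eq by apply Cmod_ge_0.
  - apply Rbar_not_lt_le. intros H. exact (CV_disk_outside _ _ H L). }
eapply ex_series_ext; [|exact (CV_disk_inside _ _ R)].
intros n. cbv beta. rewrite E, Rabs_pos_eq; [reflexivity|].
rewrite <- E. apply Cmod_ge_0.
Qed.

(** The coefficients of a product of two exponential generating functions. *)
Definition binomial_convolution (a b : nat -> C) (n : nat) : C :=
  sum_n (fun k => RtoC (Binomial.C n k) * a k * b (n - k)%nat) n.

Lemma is_egf_mult (D : C -> Prop) (F G : C -> C) (a b : nat -> C) :
  (forall t, D t -> exists s, D s /\ (Cmod t < Cmod s)%R) ->
  is_egf D F a -> is_egf D G b ->
  is_egf D (fun t => F t * G t) (binomial_convolution a b).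
Proof.
intros HD Ha Hb t Ht. destruct (HD t Ht) as [s [Hs Hts]].
eapply is_cseries_ext; [|apply (is_cseries_mult _ _ _ _ (Ha t Ht) (Hb t Ht))].
- intros n. cbv beta. unfold binomial_convolution.
  rewrite <- C_sum_n_mult_r. apply C_sum_n_ext. intros k Hk.
  unfold Binomial.C.
  replace (t ^ n) with (t ^ k * t ^ (n - k))
    by (rewrite <- Cpow_add_r; f_equal; lia).
  assert (N := RtoC_fact_neq_0).
  rewrite RtoC_div, RtoC_mult
    by (apply Rmult_integral_contrapositive_currified; apply INR_fact_neq_0).
  field. now repeat split.
- exact (abs_cvg_of_larger _ _ _ _ (Ha s Hs) Hts).
- exact (abs_cvg_of_larger _ _ _ _ (Hb s Hs) Hts).
Qed.

(** Two real power series that agree on a punctured neighbourhood of 0 have the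
    same coefficients. Shifting both by one degree multiplies them by [x], which
    makes them agree at 0 as well. *)
Lemma pseries_unique_punctured (a b : nat -> R) (r : R) :
  (0 < r)%R ->
  (forall x : R, (0 < Rabs x < r)%R -> exists l : R, is_pseries a x l /\ is_pseries b x l) ->
  forall n, a n = b n.
Proof.
intros Hr H n.
assert (RAD : forall c : nat -> R,
  (forall x : R, (0 < Rabs x < r)%R -> exists l : R, is_pseries c x l) ->
  Rbar_lt 0 (CV_radius (PS_incr_1 c))).
{ intros c Hc. rewrite CV_radius_incr_1.
  apply Rbar_lt_le_trans with (Rabs (r / 2)).
  - simpl. rewrite Rabs_pos_eq; lra.
  - apply Rbar_not_lt_le. intros L. apply (CV_disk_outside _ _ L).
    destruct (Hc (r / 2)%R) as [l Hl]; [rewrite Rabs_pos_eq; lra|].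
    apply ex_series_lim_0. exists l. now apply is_pseries_R. }
change (a n) with (PS_incr_1 a (S n)). change (b n) with (PS_incr_1 b (S n)).
apply PSeries_ext_recip.
- apply RAD. intros x Hx. destruct (H x Hx) as [l [Hl _]]. now exists l.
- apply RAD. intros x Hx. destruct (H x Hx) as [l [_ Hl]]. now exists l.
- exists (mkposreal r Hr). intros x Hx.
  change (Rabs (x - 0) < r)%R in Hx. rewrite Rminus_0_r in Hx.
  rewrite !PSeries_incr_1.
  destruct (Req_dec x 0) as [->|Hx0]; [now rewrite !Rmult_0_l|].
  destruct (H x) as [l [Ha Hb]]; [split; [now apply Rabs_pos_lt|exact Hx]|].
  now rewrite (is_pseries_unique _ _ _ Ha), (is_pseries_unique _ _ _ Hb).
Qed.

Lemma is_egf_unique (D : C -> Prop) (G : C -> C) (a b : nat -> C) (r : R) :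
  (0 < r)%R -> (forall x : R, (0 < Rabs x < r)%R -> D (RtoC x)) ->
  is_egf D G a -> is_egf D G b -> forall n, a n = b n.
Proof.
intros Hr HD Ha Hb n.
assert (T : forall (c : nat -> C) (x : R), is_egf D G c -> (0 < Rabs x < r)%R ->
  is_pseries (fun n => Re (c n) / INR (fact n))%R x (Re (G (RtoC x))) /\
  is_pseries (fun n => Im (c n) / INR (fact n))%R x (Im (G (RtoC x)))).
{ intros c x Hc Hx. assert (S := Hc _ (HD x Hx)).
  assert (E : forall k, c k * (RtoC x ^ k / RtoC (INR (fact k)))
    = c k * RtoC (x ^ k / INR (fact k))).
  { intros k. now rewrite RtoC_div, RtoC_pow by apply INR_fact_neq_0. }
  assert (ER : forall k, Re (c k * (RtoC x ^ k / RtoC (INR (fact k))))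
    = (Re (c k) / INR (fact k) * x ^ k)%R)
    by (intros k; rewrite E, re_scal_r; unfold Rdiv; ring).
  assert (EI : forall k, Im (c k * (RtoC x ^ k / RtoC (INR (fact k))))
    = (Im (c k) / INR (fact k) * x ^ k)%R)
    by (intros k; rewrite E, im_scal_r; unfold Rdiv; ring).
  apply is_cseries_Re_Im in S as [SR SI].
  split; apply is_pseries_R;
    [exact (is_series_ext _ _ _ ER SR) | exact (is_series_ext _ _ _ EI SI)]. }
assert (N := INR_fact_neq_0 n).
assert (ER := pseries_unique_punctured
  (fun n => Re (a n) / INR (fact n))%R (fun n => Re (b n) / INR (fact n))%R r Hr
  (fun x Hx => ex_intro _ _ (conj (proj1 (T a x Ha Hx)) (proj1 (T b x Hb Hx)))) n).
assert (EI := pseries_unique_punctured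
  (fun n => Im (a n) / INR (fact n))%R (fun n => Im (b n) / INR (fact n))%R r Hr
  (fun x Hx => ex_intro _ _ (conj (proj2 (T a x Ha Hx)) (proj2 (T b x Hb Hx)))) n).
cbv beta in ER, EI.
apply injective_projections.
- change (Re (a n) = Re (b n)). apply Rmult_eq_reg_r in ER; [exact ER|].
  now apply Rinv_neq_0_compat.
- change (Im (a n) = Im (b n)). apply Rmult_eq_reg_r in EI; [exact EI|].
  now apply Rinv_neq_0_compat.
Qed.

Lemma egf_coeff_eq (D : C -> Prop) (G : C -> C) (a : nat -> C) (r : R) :
  (0 < r)%R -> (forall x : R, (0 < Rabs x < r)%R -> D (RtoC x)) ->
  is_egf D G a -> forall n, egf_coeff D G n = a n.
Proof.
intros Hr HD Ha. apply (is_egf_unique D G _ _ r Hr HD); [|exact Ha].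
apply egf_coeff_spec. now exists a.
Qed.

Lemma egf_coeff_none (D : C -> Prop) (G : C -> C) (n : nat) :
  ~ (exists a, is_egf D G a) -> egf_coeff D G n = 0.
Proof.
intros H. unfold egf_coeff.
destruct (excluded_middle_informative _) as [h|_]; [contradiction|reflexivity].
Qed.

Lemma is_egf_ext (D : C -> Prop) (F G : C -> C) (a : nat -> C) :
  (forall t, D t -> F t = G t) -> is_egf D F a -> is_egf D G a.
Proof. intros E H t Ht. rewrite <- E by exact Ht. now apply H. Qed.

(** * The domain of the Apostol type functions *)

Lemma Clog_neq_0 (z : C) : z <> 0 -> z <> 1 -> Clog z <> 0.
Proof.
intros Hz Hz1 H. apply Hz1.
assert (L : ln (Cmod z) = 0%R) by exact (f_equal fst H).
assert (A : Carg z = 0%R) by exact (f_equal snd H).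
assert (P := proj1 (Cmod_gt_0 z) Hz).
assert (M : Cmod z = 1%R).
{ apply ln_inv; [exact P|lra|]. now rewrite ln_1. }
assert (A' : acos (Re z) = 0%R).
{ unfold Carg in A. rewrite M in A. unfold Rdiv in A.
  rewrite Rinv_1, Rmult_1_r in A. destruct (Rle_dec 0 (Im z)); lra. }
assert (B := re_le_Cmod z). rewrite M in B. apply Rabs_le_between in B.
assert (R1 : Re z = 1%R).
{ rewrite <- (cos_acos (Re z)), A', cos_0 by lra. reflexivity. }
assert (Q := Cmod2_alt z).
assert (I0 : Im z = 0%R).
{ apply RtoC_inj.
  assert (Q' : (Cmod z ^ 2 = Re z ^ 2 + Im z ^ 2)%R) by exact Q.
  rewrite M, R1 in Q'. f_equal. nra. }
destruct z as [p q]. cbn in R1, I0. now subst.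
Qed.

Lemma apostol_domain_disc (lam : C) :
  (forall t, apostol_domain lam t <-> t <> 0) \/
  exists r : R, (0 < r)%R /\
    forall t, apostol_domain lam t <-> t <> 0 /\ (Cmod t < r)%R.
Proof.
unfold apostol_domain.
destruct (excluded_middle_informative (lam = 0)) as [->|H0].
- left. intros t. split; [tauto|]. intros Ht. repeat split; [exact Ht|tauto|].
  intros E. exfalso. apply (f_equal Re) in E. cbn in E. lra.
- right. destruct (excluded_middle_informative (lam = - 1)) as [H1|H1].
  + exists (2 * PI)%R. split; [generalize PI_RGT_0; lra|]. intros t. tauto.
  + exists (Cmod (Clog (- lam))). split; [|intros t; tauto].
    apply Cmod_gt_0, Clog_neq_0; intros E.
    * apply H0. replace lam with (- - lam) by ring. rewrite E. ring.
    * apply H1. replace lam with (- - lam) by ring. rewrite E.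
      apply injective_projections; cbn; ring.
Qed.

Lemma apostol_domain_punctured (lam : C) :
  exists r : R, (0 < r)%R /\
    forall x : R, (0 < Rabs x < r)%R -> apostol_domain lam (RtoC x).
Proof.
assert (N : forall x : R, (0 < Rabs x)%R -> RtoC x <> 0).
{ intros x Hx. apply Cmod_gt_0. now rewrite Cmod_R. }
destruct (apostol_domain_disc lam) as [H|[r [Hr H]]].
- exists 1%R. split; [lra|]. intros x Hx. now apply H, N.
- exists r. split; [exact Hr|]. intros x Hx. apply H.
  split; [now apply N | now rewrite Cmod_R].
Qed.

Lemma apostol_domain_open (lam t : C) :
  apostol_domain lam t ->
  exists s, apostol_domain lam s /\ (Cmod t < Cmod s)%R.
Proof.
intros Ht.
assert (Ht0 : (0 < Cmod t)%R) by apply Cmod_gt_0, Ht.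
destruct (apostol_domain_disc lam) as [H|[r [Hr H]]].
- exists (RtoC (Cmod t + 1)). rewrite H, Cmod_gt_0, Cmod_R, Rabs_pos_eq by lra.
  lra.
- apply H in Ht as [_ Ht]. exists (RtoC ((Cmod t + r) / 2)).
  rewrite H, Cmod_gt_0, Cmod_R, Rabs_pos_eq by lra. lra.
Qed.

(** * The addition formula *)

Theorem theorem2p4 (alpha : nat) (lam eta delta x1 x2 x3 : C) (n : nat)
  (hn : (1 <= n)%nat) :
  bell_apostol alpha lam eta delta (x1 + x2) x3 n =
  sum_n (fun k : nat =>
           RtoC (Binomial.C n k)
           * apostol alpha lam eta delta x1 k
           * bell x2 x3 (n - k)) n.
Proof.
destruct (apostol_domain_punctured lam) as [r [Hr HD]].
assert (HO := apostol_domain_open lam).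
set (A := fun t => apostol_factor alpha lam eta delta t * Cexp (x1 * t)).
set (B := fun x y t => Cexp (x * t) * Cexp (y * (Cexp t - 1))).
set (AB := fun t => apostol_factor alpha lam eta delta t
                    * Cexp ((x1 + x2) * t + x3 * (Cexp t - 1))).
assert (HB : forall x y, is_egf (apostol_domain lam) (B x y) (bell x y)).
{ intros x y t _. exact (egf_coeff_spec _ _ (bell_egf_exists x y) t I). }
destruct (excluded_middle_informative
  (exists a, is_egf (apostol_domain lam) A a)) as [HA|HA].
- assert (P := is_egf_mult _ _ _ _ _ HO (egf_coeff_spec _ _ HA) (HB x2 x3)).
  refine (egf_coeff_eq _ AB (binomial_convolution _ _) r Hr HD _ n).
  revert P. apply is_egf_ext. intros t _. unfold A, B, AB.
  rewrite <- Cmult_assoc, <- !Cexp_plus. do 2 f_equal. ring.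
- assert (HAB : ~ exists a, is_egf (apostol_domain lam) AB a).
  { intros [c Hc]. apply HA. eexists.
    (* [B (- x2) (- x3)] is the inverse of [B x2 x3]. *)
    apply (is_egf_ext _ (fun t => AB t * B (- x2) (- x3) t)).
    - intros t _. unfold A, B, AB.
      rewrite <- Cmult_assoc, <- !Cexp_plus. do 2 f_equal. ring.
    - apply (is_egf_mult _ _ _ _ _ HO Hc (HB _ _)). }
  unfold bell_apostol. fold AB. rewrite (egf_coeff_none _ _ _ HAB).
  rewrite (C_sum_n_ext _ (fun k => 0 * 0)).
  + rewrite C_sum_n_mult_l. ring.
  + intros k _. unfold apostol. fold A. rewrite (egf_coeff_none _ _ _ HA). ring.
Qed.
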